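(* Let $(V,\omega)$ be a real $2n$-dimensional symplectic vector space. Suppose $W\subseteq V$ is a linear subspace of type $\vec n=(n_0,n_+,n_-)$ and let $(W_+,W_-,W^0)$ be any splitting of $V$ associated to $W$. Then $(W_\pm,\omega|_{W_\pm})$ are symplectic subspaces of $V$, and there exists a Darboux basis $$\{e^0_1,\dots,e^0_{n_0},e^+_1,\dots,e^+_{n_+},e^-_1,\dots,e^-_{n_-},f^0_1,\dots,f^0_{n_0},f^+_1,\dots,f^+_{n_+},f^-_1,\dots,f^-_{n_-}\}$$ of $V$ such that $W_0=\operatorname{span}_{\mathbb R}\{e^0_j\}_{1\le j\le n_0}$, $W^0=\operatorname{span}_{\mathbb R}\{f^0_j\}_{1\le j\le n_0}$, $W_+=\operatorname{span}_{\mathbb R}\{e^+_\ell,f^+_\ell\}_{1\le\ell\le n_+}$ and $W_-=\operatorname{span}_{\mathbb R}\{e^-_\ell,f^-_\ell\}_{1\le\ell\le n_-}$.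
   Context: For a subspace $W\subseteq V$: $W^\omega=\{v\in V:\omega(v,w)=0\ \forall w\in W\}$ and $W_0=W\cap W^\omega$. $W$ has type $(n_0,n_+,n_-)$ if $\dim_{\mathbb R}W_0=n_0$, $\dim_{\mathbb R}W/W_0=2n_+$ and $n_-=n-n_0-n_+$ (so $\dim_{\mathbb R}W^\omega/W_0=2n_-$). A splitting of $V$ associated to $W$ is a triple $(W_+,W_-,W^0)$ of subspaces of $V$ such that $W_+$ is complementary to $W_0$ in $W$, $W_-$ is complementary to $W_0$ in $W^\omega$, and $W^0$ is an isotropic subspace of $V$ complementary to $W_0$ in $(W_+\oplus W_-)^\omega$. A Darboux basis is a basis consisting of vectors $e$'s and $f$'s (paired by their indices) with $\omega(e_j,f_k)=\delta_{jk}$ and $\omega(e_j,e_k)=\omega(f_j,f_k)=0$. *)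

(* Defs.v *)
From HB Require Import structures.
From mathcomp Require Import all_boot all_order all_algebra.
From mathcomp Require Import reals.
Set Implicit Arguments.
Unset Strict Implicit.
Unset Printing Implicit Defensive.
Import GRing.Theory.
Local Open Scope ring_scope.

Section RestrictedForm.
Variables (F : fieldType) (V : vectType F) (omega : {skew_symmetric V}).
Variable U : {vspace V}.

Definition restr_form (u v : subvs_of U) : F := omega (vsval u) (vsval v).

Fact restr_form_bilinear : bilinear_for *%R (idfun \; *%R) restr_form.
Proof.
split=> w a u v; rewrite /restr_form (linearP vsval).
  by rewrite linearDl linearZl_LR.
by rewrite linearDr linearZr_LR.
Qed.

HB.instance Definition _ := bilinear_isBilinear.Build F (subvs_of U)
  (subvs_of U) F *%R (idfun \; *%R) restr_form restr_form_bilinear.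

Fact restr_form_skew u v :
  restr_form u v = (-1) ^+ true * idfun (restr_form v u).
Proof. exact: hermC. Qed.

HB.instance Definition _ := isHermitianSesquilinear.Build F (subvs_of U)
  true idfun restr_form restr_form_skew.

End RestrictedForm.
Arguments restr_form {F V} omega U u v.

Section SymplecticSubspaces.
Variables (F : fieldType) (V : vectType F) (omega : {skew_symmetric V}).
Implicit Types (U W : {vspace V}).

Definition symplectic_subspace U := is_psymplectic (restr_form omega U).

Definition isotropic U := (U <= orthov omega U)%VS.

Definition radical W := (W :&: orthov omega W)%VS.

Definition complementary_in U1 U2 U :=
  (U1 + U2)%VS = U /\ (U1 :&: U2)%VS = 0%VS.

(* Quotient spaces are not available, so dim (W / W_0) is written as the
   difference of dimensions (not truncated, since W_0 is contained in W).
   The last clause is n_- = n - n_0 - n_+ for integers, without truncation. *)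
Definition has_type (n : nat) W (n0 np nm : nat) :=
  [/\ \dim (radical W) = n0,
      (\dim W - \dim (radical W) = 2 * np)%N
    & (n0 + np + nm = n)%N].

Definition splitting W Wp Wm Wo :=
  [/\ complementary_in Wp (radical W) W,
      complementary_in Wm (radical W) (orthov omega W),
      isotropic Wo
    & complementary_in Wo (radical W) (orthov omega (Wp + Wm))].

Definition darboux_basis m (e f : m.-tuple V) :=
  [/\ basis_of fullv (e ++ f),
      forall j k, omega (tnth e j) (tnth f k) = (j == k)%:R,
      forall j k, omega (tnth e j) (tnth e k) = 0
    & forall j k, omega (tnth f j) (tnth f k) = 0].

End SymplecticSubspaces.

(* Main.v *)
Require Import Defs.
From HB Require Import structures.
From mathcomp Require Import all_boot all_order all_algebra.
From mathcomp Require Import reals.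
From mathcomp Require Import zify.
Set Implicit Arguments.
Unset Strict Implicit.
Unset Printing Implicit Defensive.
Import GRing.Theory.
Local Open Scope ring_scope.

(** Everything rests on one construction: two subspaces [A] and [B] that
    [omega] pairs perfectly have dual bases ([dual_bases]), obtained by
    splitting off one vector at a time from each.  Pairing a subspace [U] with
    a complement of its orthogonal gives the dimension formula
    [dim U + dim U^omega = dim V], hence [U^omega^omega = U], for a
    nondegenerate [omega].

    A complement of the radical of any subspace meets its own orthogonal
    trivially ([nondeg_compl_radical]).  Since [W] and [W^omega] have the same
    radical [W_0], this applies to [W_+] and to [W_-], which are therefore
    symplectic and have Darboux bases ([symplectic_basis]).  They are
    orthogonal to each other, so [W_+ + W_-] is nondegenerate, and so is its
    orthogonal [W^0 + W_0].  Both summands of the latter are isotropic, hence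
    [omega] pairs them perfectly, and dual bases of [W_0] and [W^0] complete
    the Darboux basis.

    The three families are mutually orthogonal, so their concatenation
    satisfies the Darboux relations.  A family that has a dual family is free,
    and [e ++ f] is dual to [f ++ - e] when [e] and [f] satisfy the Darboux
    relations; as there are [2 n] vectors in all, they form a basis of [V]. *)

Section DarbouxBases.
Variables (F : fieldType) (V : vectType F) (omega : {skew_symmetric V}).
Implicit Types (a b x y : V) (A B P S U W : {vspace V}) (e f : seq V).

Local Notation "U ^_|_" := (orthov omega U).
Local Notation "U '_|_ W" := (U <= orthov omega W)%VS.

Definition nondeg U := (U :&: U^_|_ = 0)%VS.

Definition dual_families e f := size e = size f /\
  forall i j, (i < size e)%N -> (j < size e)%N ->
    omega e`_i f`_j = (i == j)%:R.

(** * Orthogonality *)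

Lemma skewC x y : omega x y = - omega y x.
Proof. by rewrite hermC expr1 mulN1r. Qed.

(** In characteristic other than 2 this is skew-symmetry; in characteristic 2
    it is part of being symplectic. *)
Lemma psymplectic_alternating : is_psymplectic omega ->
  forall x, omega x x = 0.
Proof.
case=> _ _ alt2 x; have [/alt2->//|char2] := boolP (2 \in [pchar F]).
have /eqP : omega x x *+ 2 = 0 by rewrite mulr2n {1}skewC addNr.
rewrite -mulr_natr mulf_eq0 => /orP[/eqP//|two0].
by rewrite inE /= two0 in char2.
Qed.

Lemma sub_orthov U W : (U <= W)%VS -> (W^_|_ <= U^_|_)%VS.
Proof.
move=> /subvP sUW; apply/orthovP => x y /mem_orthovP xW /sUW; exact: xW.
Qed.

Lemma orthovS A B U W :
  (A <= U)%VS -> (B <= W)%VS -> U '_|_ W -> A '_|_ B.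
Proof.
move=> sAU sBW UW; exact: subv_trans sAU (subv_trans UW (sub_orthov sBW)).
Qed.

Lemma orthov_add U W : ((U + W)^_|_ = U^_|_ :&: W^_|_)%VS.
Proof.
apply/eqP; rewrite eqEsubv subv_cap !sub_orthov ?addvSl ?addvSr //=.
by rewrite orthovD capvSl capvSr.
Qed.

Lemma nondeg_add U W : nondeg U -> nondeg W -> U '_|_ W -> nondeg (U + W).
Proof.
move=> ndU ndW UW; have WU : W '_|_ U by rewrite orthov_sym.
apply/eqP; rewrite -subv0 orthov_add; apply/subvP => x.
case/memv_capP => /memv_addP[u uU [w wW ->]] /memv_capP[xU xW].
have u0 : u = 0.
  apply/eqP; rewrite -memv0 -ndU memv_cap uU -[u](addrK w).
  by rewrite rpredB // (subvP WU).
have w0 : w = 0.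
  apply/eqP; rewrite -memv0 -ndW memv_cap wW -[w](addKr u).
  by rewrite rpredD // rpredN (subvP UW).
by rewrite u0 w0 addr0 mem0v.
Qed.

(** A vector of [P] orthogonal to [P] is orthogonal to all of [U], being
    orthogonal to the radical anyway, so it lies in the radical as well. *)
Lemma nondeg_compl_radical U P :
  complementary_in P (radical omega U) U -> nondeg P.
Proof.
case=> defU dxP; have sPU : (P <= U)%VS by rewrite -defU addvSl.
apply/eqP; rewrite -subv0 -dxP subv_cap capvSl /radical subv_cap.
rewrite (subv_trans (capvSl _ _) sPU) /= -defU orthov_add subv_cap capvSr /=.
rewrite (subv_trans (capvSl _ _)) // (subv_trans sPU) // orthov_sym.
exact: capvSr.
Qed.

Lemma isotropic_cat e f :
    isotropic omega <<e>>%VS -> isotropic omega <<f>>%VS ->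
  <<e>>%VS '_|_ <<f>>%VS -> isotropic omega <<e ++ f>>%VS.
Proof.
rewrite /isotropic => isoe isof ef.
by rewrite span_cat orthoDv !orthovD isoe isof ef orthov_sym ef.
Qed.

Lemma isotropic_pair_perfect A B :
  nondeg (A + B) -> isotropic omega A -> (A :&: B^_|_ = 0)%VS.
Proof.
move=> ndAB isoA; apply/eqP; rewrite -subv0 -ndAB orthov_add !subv_cap.
by rewrite capvSr (subv_trans (capvSl _ _)) ?addvSl // (subv_trans (capvSl _ _)).
Qed.

(** * Dual families *)

Lemma dual_families1 a b : omega a b = 1 -> dual_families [:: a] [:: b].
Proof. by move=> ab1; split=> // -[] // -[]. Qed.

Lemma dual_families_cat e1 f1 e2 f2 :
    dual_families e1 f1 -> dual_families e2 f2 ->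
    <<e1>>%VS '_|_ <<f2>>%VS -> <<e2>>%VS '_|_ <<f1>>%VS ->
  dual_families (e1 ++ e2) (f1 ++ f2).
Proof.
case=> sz1 du1 [sz2 du2] /orthovP o12 /orthovP o21.
split=> [|i j]; first by rewrite !size_cat sz1 sz2.
rewrite !size_cat !nth_cat -sz1; have [lti|lei] := ltnP i (size e1);
  have [ltj|lej] := ltnP j (size e1) => lt_i lt_j.
- exact: du1.
- rewrite o12 ?memv_span ?mem_nth // -?sz2 ?ltn_subLR //.
  by rewrite ltn_eqF // (leq_trans lti).
- rewrite o21 ?memv_span ?mem_nth // -?sz1 ?ltn_subLR //.
  by rewrite gtn_eqF // (leq_trans ltj).
- rewrite du2 ?ltn_subLR //.
  by rewrite -(eqn_add2l (size e1)) !subnKC.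
Qed.

Lemma dual_families_free e f : dual_families e f -> free e.
Proof.
case=> _ du; rewrite -[e]in_tupleE; apply/freeP => k sum0 i.
have /(congr1 (omega^~ f`_i)) := sum0.
rewrite linear0l linear_sumlz (bigD1 i) //= linearZl_LR /= du // eqxx mulr1.
rewrite big1 ?addr0 // => j neq_ji.
by rewrite linearZl_LR /= du // val_eqE (negbTE neq_ji) mulr0.
Qed.

Lemma dual_families_opp e f :
  dual_families e f -> dual_families f (map -%R e).
Proof.
case=> sz du; split=> [|i j]; rewrite -sz ?size_map // => lti ltj.
by rewrite (nth_map 0) // linearNr -skewC du // eq_sym.
Qed.

(** The Darboux relations say exactly that [f ++ - e] is dual to [e ++ f]. *)
Lemma darboux_free e f : dual_families e f ->
  isotropic omega <<e>>%VS -> isotropic omega <<f>>%VS -> free (e ++ f).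
Proof.
move=> du isoe isof.
apply: (@dual_families_free _ (f ++ map -%R e)).
apply: dual_families_cat (dual_families_opp du) _ isof => //.
rewrite (subv_trans isoe) // sub_orthov //; apply/span_subvP => _ /mapP[x xe ->].
by rewrite memvN memv_span.
Qed.

(** * Splitting off vectors *)

(** The projection onto [<[a]>] along the orthogonal of [b] stays in [A]. *)
Lemma split_line A a b : a \in A -> omega a b != 0 ->
  A = (<[a]> + (A :&: <[b]>^_|_))%VS.
Proof.
move=> aA ab0; apply/eqP; rewrite eqEsubv subv_add capvSl -memvE aA !andbT.
apply/subvP => x xA; set c := omega x b / omega a b.
rewrite -[x](subrK (c *: a)) addrC memv_add ?rpredZ ?memv_line //.
rewrite memv_cap rpredB ?rpredZ //= mem_orthov1.
by rewrite linearBl linearZl_LR /= divfK // subrr.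
Qed.

Lemma dim_split_line A a b : a \in A -> omega a b != 0 ->
  (\dim (A :&: <[b]>^_|_) < \dim A)%N.
Proof.
move=> aA ab0; rewrite ltn_neqAle dimvS ?capvSl // andbT.
rewrite (dimv_leqif_eq (capvSl _ _)); apply: contra ab0 => /eqP defA.
by move: aA; rewrite -{1}defA memv_cap mem_orthov1 => /andP[].
Qed.

Lemma exists_partner A B : (A :&: B^_|_ = 0)%VS -> A != 0%VS ->
  exists a b, [/\ a \in A, b \in B & omega a b = 1].
Proof.
move=> dxAB nzA; have aA := memv_pick A; set a := vpick A in aA.
have : a \notin B^_|_.
  apply: contra nzA => aB.
  by rewrite -vpick0 -memv0 -dxAB memv_cap aA aB.
case/mem_orthovPn => b bB ab0; exists a, ((omega a b)^-1 *: b).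
by rewrite rpredZ // linearZr_LR /= mulVf.
Qed.

(** After [a] and [b] with [omega a b = 1] are split off, the orthogonal of
    [b] in [A] and that of [a] in [B] are still perfectly paired. *)
Lemma dual_bases A B : (A :&: B^_|_ = 0)%VS -> (B :&: A^_|_ = 0)%VS ->
  exists e f, [/\ dual_families e f, <<e>>%VS = A & <<f>>%VS = B].
Proof.
have [m leAm] := ubnP (\dim A); elim: m A B leAm => // m IHm A B.
rewrite ltnS => leAm dxAB dxBA; have [A0|nzA] := eqVneq A 0%VS.
  exists [::], [::]; rewrite span_nil A0; split=> //.
  by rewrite -dxBA A0 orthov0 capvf.
have [a [b [aA bB ab1]]] := exists_partner dxAB nzA.
have ab0 : omega a b != 0 by rewrite ab1 oner_eq0.
have ba0 : omega b a != 0 by rewrite herm_eq0C.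
have defA := split_line aA ab0; have defB := split_line bB ba0.
set A' := (A :&: _)%VS in defA; set B' := (B :&: _)%VS in defB.
have [|||e [f [du spane spanf]]] := IHm A' B'.
- exact: leq_trans (dim_split_line aA ab0) leAm.
- apply/eqP; rewrite -subv0 -dxAB defB orthov_add !subv_cap capvSr andbT.
  by apply/andP; split; apply: subv_trans (capvSl _ _) _;
    rewrite ?capvSl ?capvSr.
- apply/eqP; rewrite -subv0 -dxBA defA orthov_add !subv_cap capvSr andbT.
  by apply/andP; split; apply: subv_trans (capvSl _ _) _;
    rewrite ?capvSl ?capvSr.
exists ([:: a] ++ e), ([:: b] ++ f).
rewrite !span_cat !span_seq1 spane spanf -defA -defB; split=> //.
apply: dual_families_cat (dual_families1 ab1) du _ _;
  rewrite span_seq1 ?spane ?spanf; last exact: capvSr.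
by rewrite orthov_sym capvSr.
Qed.

Lemma dim_perfect_pair A B : (A :&: B^_|_ = 0)%VS -> (B :&: A^_|_ = 0)%VS ->
  \dim A = \dim B.
Proof.
move=> dxAB dxBA; have [e [f [du <- <-]]] := dual_bases dxAB dxBA.
have := dual_families_free (dual_families_opp du).
have := dual_families_free du; rewrite /free => /eqP-> /eqP->.
by case: du.
Qed.

(** The plane spanned by [a] and [b] is split off as two lines: [b] remains in
    the orthogonal of [b] because [omega] is alternating. *)
Lemma symplectic_basis U : (forall x, omega x x = 0) -> nondeg U ->
  exists e f, [/\ dual_families e f, isotropic omega <<e>>%VS,
                  isotropic omega <<f>>%VS & <<e ++ f>>%VS = U].
Proof.
move=> alt; have [m leUm] := ubnP (\dim U); elim: m U leUm => // m IHm U.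
rewrite ltnS => leUm ndU; have [U0|nzU] := eqVneq U 0%VS.
  by exists [::], [::]; rewrite /isotropic /= span_nil U0 !sub0v.
have [a [b [aU bU ab1]]] := exists_partner ndU nzU.
have ab0 : omega a b != 0 by rewrite ab1 oner_eq0.
have ba0 : omega b a != 0 by rewrite herm_eq0C.
have bU1 : b \in (U :&: <[b]>^_|_)%VS by rewrite memv_cap bU mem_orthov1 alt /=.
have := split_line aU ab0; rewrite (split_line bU1 ba0).
set U' := (_ :&: <[a]>^_|_)%VS => defU.
have U'a : U' '_|_ <[a]> by apply: capvSr.
have U'b : U' '_|_ <[b]> by apply: subv_trans (capvSl _ _) (capvSr _ _).
have aU' : <[a]>%VS '_|_ U' by rewrite orthov_sym.
have bU' : <[b]>%VS '_|_ U' by rewrite orthov_sym.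
have sU'U : (U' <= U)%VS by apply: subv_trans (capvSl _ _) (capvSl _ _).
have [||e [f [du isoe isof defU']]] := IHm U'.
- apply: leq_trans leUm; apply: leq_trans (dim_split_line aU ab0).
  by rewrite ltnS dimvS // capvSl.
- apply/eqP; rewrite -subv0 -ndU {2}defU !orthov_add !subv_cap capvSr andbT.
  by apply/and3P; split=> //; apply: subv_trans (capvSl _ _) _.
have [seU' sfU'] : (<<e>> <= U')%VS /\ (<<f>> <= U')%VS.
  by rewrite -defU' span_cat addvSl addvSr.
have iso_cons x g : U' '_|_ <[x]> -> (<<g>> <= U')%VS ->
    isotropic omega <<g>>%VS -> isotropic omega <<[:: x] ++ g>>%VS.
  move=> U'x sgU' isog; apply: isotropic_cat => //.
    by rewrite /isotropic span_seq1 orthov11 alt.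
  by rewrite span_seq1 orthov_sym (subv_trans sgU').
exists ([:: a] ++ e), ([:: b] ++ f); split; try exact: iso_cons.
  apply: dual_families_cat (dual_families1 ab1) du _ _; rewrite span_seq1.
    exact: orthovS sfU' aU'.
  exact: orthovS seU' _ U'b.
rewrite defU -defU' !span_cat !span_seq1 -!addvA; congr (_ + _)%VS.
by rewrite !addvA; congr (_ + _)%VS; rewrite addvC.
Qed.

(** * Orthogonals for a nondegenerate form *)

Lemma symplectic_of_nondeg U : is_psymplectic omega -> nondeg U ->
  symplectic_subspace omega U.
Proof.
move=> /psymplectic_alternating alt ndU; split=> [||_ u]; last 2 first.
- by split.
- exact: alt.
rewrite /nondegenerate -subv0; apply/subvP => u /mem_orthovP u_orth.
rewrite memv0; apply/eqP/val_inj/eqP; rewrite -memv0 -ndU memv_cap subvsP /=.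
apply/mem_orthovP => w wU; rewrite -(vsprojK wU); exact/u_orth/memvf.
Qed.

Hypothesis omega_nondeg : nondegenerate omega.

(** [U] is perfectly paired with any complement of its orthogonal. *)
Lemma dim_orthov U : (\dim U + \dim U^_|_)%N = \dim {:V}.
Proof.
have dxCU := capv_compl U^_|_; set C := (_^C)%VS in dxCU.
have dxUC : (U :&: C^_|_ = 0)%VS.
  apply/eqP; rewrite -subv0 -(eqP omega_nondeg) -(addv_complf U^_|_).
  rewrite orthov_add subv_cap capvSr andbT (subv_trans (capvSl _ _)) //.
  by rewrite orthov_sym.
rewrite (dim_perfect_pair dxUC); last by rewrite capvC.
by rewrite addnC -dimv_disjoint_sum // addv_complf.
Qed.

Lemma orthovK U : ((U^_|_)^_|_ = U)%VS.
Proof.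
apply/esym/eqP; rewrite eqEdim orthov_sym subvv /=.
by rewrite -(leq_add2l (\dim U^_|_)) dim_orthov addnC dim_orthov.
Qed.

Lemma nondeg_orthov U : nondeg U -> nondeg U^_|_.
Proof. by rewrite /nondeg orthovK capvC. Qed.

Lemma radical_orthov W : radical omega W^_|_ = radical omega W.
Proof. by rewrite /radical orthovK capvC. Qed.

End DarbouxBases.

(** * Bases of prescribed size *)

Section DarbouxTuples.
Variables (F : fieldType) (V : vectType F) (omega : {skew_symmetric V}).

Lemma darboux_basisP m (e f : m.-tuple V) :
    \dim {:V} = (2 * m)%N -> dual_families omega e f ->
    isotropic omega <<e>>%VS -> isotropic omega <<f>>%VS ->
  darboux_basis omega e f.
Proof.
move=> dimV du isoe isof; split.
- rewrite basisEfree (darboux_free du) // subvf dimV size_cat !size_tuple.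
  by rewrite mul2n addnn leqnn.
- by case: du => _ du j k; rewrite !(tnth_nth 0) du ?size_tuple.
- by move=> j k; apply: (orthovP isoe); rewrite memv_span ?mem_tnth.
- by move=> j k; apply: (orthovP isof); rewrite memv_span ?mem_tnth.
Qed.

Lemma symplectic_tuple_basis m (U : {vspace V}) :
    (forall x, omega x x = 0) -> nondeg omega U -> \dim U = (2 * m)%N ->
  exists e f : m.-tuple V,
    [/\ dual_families omega e f, isotropic omega <<e>>%VS,
        isotropic omega <<f>>%VS & <<e ++ f>>%VS = U].
Proof.
move=> alt ndU dimU; have [e [f [du isoe isof defU]]] := symplectic_basis alt ndU.
have sz_ef := du.1.
have sz_e : size e == m.
  have := darboux_free du isoe isof; rewrite /free defU dimU size_cat -sz_ef.
  by rewrite addnn -mul2n eqn_pmul2l // eq_sym.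
have sz_f : size f == m by rewrite -sz_ef.
by exists (Tuple sz_e), (Tuple sz_f).
Qed.

Lemma dual_tuple_bases m (A B : {vspace V}) :
    (A :&: orthov omega B = 0)%VS -> (B :&: orthov omega A = 0)%VS ->
    \dim A = m ->
  exists e f : m.-tuple V,
    [/\ dual_families omega e f, <<e>>%VS = A & <<f>>%VS = B].
Proof.
move=> dxAB dxBA dimA; have [e [f [du defA defB]]] := dual_bases dxAB dxBA.
have sz_e : size e == m.
  by have := dual_families_free du; rewrite /free defA dimA eq_sym.
have sz_f : size f == m by rewrite -du.1.
by exists (Tuple sz_e), (Tuple sz_f).
Qed.

End DarbouxTuples.

(** * Adapted Darboux bases *)

Theorem theorem2p2 (R : realType) (n : nat) (V : vectType R)
    (dimV : \dim {:V} = (2 * n)%N)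
    (omega : {skew_symmetric V}) (omegaP : is_psymplectic omega)
    (W : {vspace V}) (n0 np nm : nat) (typeW : has_type omega n W n0 np nm)
    (Wp Wm Wo : {vspace V}) (splitW : splitting omega W Wp Wm Wo) :
  [/\ symplectic_subspace omega Wp,
      symplectic_subspace omega Wm
    & exists (e0 f0 : n0.-tuple V) (ep fp : np.-tuple V) (em fm : nm.-tuple V),
      [/\ darboux_basis omega [tuple of e0 ++ ep ++ em]
                              [tuple of f0 ++ fp ++ fm],
          radical omega W = <<e0>>%VS,
          Wo = <<f0>>%VS,
          Wp = <<ep ++ fp>>%VS
        & Wm = <<em ++ fm>>%VS]].
Proof.
have [omega_nd _ _] := omegaP; have alt := psymplectic_alternating omegaP.
have [dimW0 dimWW0 sum_n] := typeW.
have [splitp splitm isoWo [defO dxO]] := splitW.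
have ndp := nondeg_compl_radical splitp.
have ndm : nondeg omega Wm.
  apply: (@nondeg_compl_radical _ _ _ (orthov omega W)).
  by rewrite radical_orthov.
have [defW dxp] := splitp; have [defW' dxm] := splitm.
(* [W_+] lies in [W], the orthogonal of [W^omega], which contains [W_-]. *)
have orth_pm : (Wp <= orthov omega Wm)%VS.
  rewrite -(orthovK omega_nd Wp) sub_orthov //.
  apply: (@subv_trans _ _ (orthov omega W)); first by rewrite -defW' addvSl.
  by rewrite sub_orthov // -defW addvSl.
have nd0 : nondeg omega (Wo + radical omega W)%VS.
  by rewrite defO; apply/nondeg_orthov/nondeg_add.
have iso0 : isotropic omega (radical omega W).
  rewrite /isotropic (subv_trans (capvSl _ _)) // orthov_sym; exact: capvSr.
have dimWp : \dim Wp = (2 * np)%N.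
  by rewrite -dimWW0 -{1}defW dimv_disjoint_sum // addnK.
(* Count dimensions in [dim W + dim W^omega = 2 n]. *)
have dimWm : \dim Wm = (2 * nm)%N.
  have := dim_orthov omega_nd W.
  rewrite -{1}defW -defW' !dimv_disjoint_sum // dimWp dimW0 dimV -sum_n.
  lia.
have [ep [fp [dup isoep isofp defp]]] := symplectic_tuple_basis alt ndp dimWp.
have [em [fm [dum isoem isofm defm]]] := symplectic_tuple_basis alt ndm dimWm.
have [|||e0 [f0 [du0 def0 defo]]] :=
  @dual_tuple_bases _ _ omega n0 (radical omega W) Wo.
- by apply: isotropic_pair_perfect iso0; rewrite addvC.
- exact: isotropic_pair_perfect isoWo.
- exact: dimW0.
split; try exact: symplectic_of_nondeg.
have [sep sfp] : (<<ep>> <= Wp)%VS /\ (<<fp>> <= Wp)%VS.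
  by rewrite -defp span_cat addvSl addvSr.
have [sem sfm] : (<<em>> <= Wm)%VS /\ (<<fm>> <= Wm)%VS.
  by rewrite -defm span_cat addvSl addvSr.
have orth_0 : (Wo + radical omega W <= orthov omega (Wp + Wm))%VS.
  by rewrite defO.
have [spm_e spm_f] : (<<ep ++ em>> <= Wp + Wm /\ <<fp ++ fm>> <= Wp + Wm)%VS.
  by rewrite !span_cat !addvS.
have [se0 sf0] :
  (<<e0>> <= Wo + radical omega W /\ <<f0>> <= Wo + radical omega W)%VS.
  by rewrite def0 defo addvSl addvSr.
exists e0, f0, ep, fp, em, fm; split=> //; apply: darboux_basisP => /=.
- by rewrite dimV -sum_n addnA.
- apply: dual_families_cat du0 _ _ _; last first.
  + by rewrite orthov_sym; apply: orthovS orth_0.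
  + exact: orthovS orth_0.
  apply: dual_families_cat dup dum _ _; first exact: orthovS orth_pm.
  by rewrite orthov_sym; apply: orthovS orth_pm.
- apply: isotropic_cat; first by rewrite def0.
    apply: isotropic_cat => //; exact: orthovS orth_pm.
  exact: orthovS orth_0.
- apply: isotropic_cat; first by rewrite defo.
    apply: isotropic_cat => //; exact: orthovS orth_pm.
  exact: orthovS orth_0.
Qed.
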